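(* Let $\kappa$ be a regular uncountable cardinal, $\mathbb{B}$ a $\kappa$-Souslin algebra and $\varphi$ an automorphism of $\mathbb{B}$. Then the set $\mathbb{A}=\{x\in\mathbb{B}\mid\varphi(x)=x\}$ of fixed points of $\varphi$ is a large subalgebra of $\mathbb{B}$. In particular, if $\kappa>2^{\aleph_0}$ then $\mathbb{A}$ is $2^{\aleph_0}$-large.
   Context: A $\kappa$-Souslin algebra is a complete Boolean algebra with the $\kappa$-chain condition (every antichain has fewer than $\kappa$ elements) and satisfying the $(\kappa,\infty)$-distributive law; throughout, only $\kappa$-Souslin algebras having a Souslinization (a dense subset forming, under reverse Boolean order, a normal $\kappa$-Souslin tree whose limit nodes are products of their predecessors) are considered. $\langle M\rangle^{\mathrm{cm}}$ denotes the complete subalgebra generated by $M$. A complete subalgebra $\mathbb{A}$ of a complete Boolean algebra $B$ is large if there is an antichain $M$ of $B$ with $\langle\mathbb{A}\cup M\rangle^{\mathrm{cm}}=B$, and $\mu$-large if there is such an antichain of size $\mu$. *)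

(* Defs.v *)
From HB Require Import structures.
From mathcomp Require Import all_boot all_order.
From mathcomp Require Import boolp classical_sets functions cardinality.

Set Implicit Arguments.
Unset Strict Implicit.
Unset Printing Implicit Defensive.

Import Order.TTheory.

Local Open Scope classical_set_scope.
Local Open Scope card_scope.
Local Open Scope order_scope.

Definition card_lt T U (A : set T) (B : set U) : Prop :=
  A #<= B /\ ~ (B #<= A).

(* Applied with P a Boolean algebra or a tree; the existence of least elements
   in two-element subsets makes A linearly ordered. *)
Definition well_ordered d (P : porderType d) (A : set P) : Prop :=
  forall S : set P, S `<=` A -> S !=set0 -> exists2 m, S m & lbound S m.

(* A cardinal is an initial ordinal, presented as an ordered type K: its
   elements stand for the ordinals below it. *)
Definition is_cardinal d (K : orderType d) : Prop :=
  well_ordered [set: K] /\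
  forall x : K, card_lt [set y | y < x] [set: K].

Definition regular_cardinal d (K : orderType d) : Prop :=
  is_cardinal K /\
  forall C : set K, (forall x, exists2 y, C y & x <= y) -> [set: K] #<= C.

(* ** Trees: subsets T of a partial order, growing upwards *)

Definition predecessors d (P : porderType d) (T : set P) (t : P) : set P :=
  [set s | T s /\ s < t].

Definition is_tree d (P : porderType d) (T : set P) : Prop :=
  forall t, T t -> well_ordered (predecessors T t).

(* The predecessors of t have order type a. *)
Definition at_level dK (K : orderType dK) d (P : porderType d)
    (T : set P) (a : K) (t : P) : Prop :=
  T t /\
  exists f : P -> K,
    set_bij (predecessors T t) [set b | b < a] f /\
    (forall r s, predecessors T t r -> predecessors T t s ->
       (f r <= f s) = (r <= s)).

Definition has_height dK (K : orderType dK) d (P : porderType d)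
    (T : set P) : Prop :=
  (forall t, T t -> exists a : K, at_level T a t) /\
  (forall a : K, exists t, at_level T a t).

Definition immediate_successor d (P : porderType d) (T : set P)
    (t s : P) : Prop :=
  [/\ T s, t < s & forall r, T r -> ~~ (t < r < s)].

Definition limit_node d (P : porderType d) (T : set P) (t : P) : Prop :=
  [/\ T t, predecessors T t !=set0 &
      forall s, predecessors T t s -> exists2 r, predecessors T t r & s < r].

Definition normal_tree dK (K : orderType dK) d (P : porderType d)
    (T : set P) : Prop :=
  [/\ exists2 r, T r & lbound T r,
      forall t, T t -> exists s1 s2,
        [/\ immediate_successor T t s1, immediate_successor T t s2 & s1 <> s2],
      forall (a b : K) t, at_level T a t -> a < b ->
        exists2 s, at_level T b s & t < s &
      forall s t, limit_node T s -> limit_node T t ->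
        predecessors T s = predecessors T t -> s = t].

Definition souslin_tree dK (K : orderType dK) d (P : porderType d)
    (T : set P) : Prop :=
  [/\ is_tree T,
      has_height K T,
      forall C : set P, C `<=` T ->
        total_on C (fun s t => s <= t) -> card_lt C [set: K] &
      forall C : set P, C `<=` T ->
        (forall s t, C s -> C t -> s <= t -> s = t) -> card_lt C [set: K]].

(* ** Boolean algebras *)

Definition complete_algebra d (B : ctbDistrLatticeType d) : Prop :=
  forall S : set B, supremums S !=set0.

Definition antichain d (B : ctbDistrLatticeType d) (M : set B) : Prop :=
  (forall x, M x -> x <> \bot) /\
  (forall x y, M x -> M y -> x <> y -> Order.meet x y = \bot).

Definition chain_condition dK (K : orderType dK) d
    (B : ctbDistrLatticeType d) : Prop :=
  forall M : set B, antichain M -> card_lt M [set: K].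

(* The distributive law prod_i sum_j a_ij = sum_f prod_i a_i(f i) for index
   sets I of size less than K and J arbitrary. It cannot be asked for I of
   size K: applied to the K levels of a Souslinization it would produce a
   cofinal branch. *)
Definition distributive_law dK (K : orderType dK) d
    (B : ctbDistrLatticeType d) : Prop :=
  forall (I J : Type) (a : I -> J -> B), card_lt [set: I] [set: K] ->
    infimum \top (range (fun i => supremum \bot (range (a i)))) =
    supremum \bot
      (range (fun f : I -> J => infimum \top (range (fun i => a i (f i))))).

Definition souslin_algebra dK (K : orderType dK) d
    (B : ctbDistrLatticeType d) : Prop :=
  [/\ complete_algebra B, chain_condition K B & distributive_law K B].

Definition dense_subset d (B : ctbDistrLatticeType d) (T : set B) : Prop :=
  ~ T \bot /\ forall b : B, b <> \bot -> exists2 t, T t & t <= b.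

(* Tree notions are taken in the dual order B^d, the product of the
   predecessors in B itself. *)
Definition souslinization dK (K : orderType dK) d
    (B : ctbDistrLatticeType d) (T : set B) : Prop :=
  [/\ dense_subset T,
      souslin_tree K (T : set B^d),
      normal_tree K (T : set B^d) &
      forall t : B, limit_node (T : set B^d) t ->
        infimums [set s : B | T s /\ t < s] t].

Definition ba_automorphism d (B : ctbDistrLatticeType d)
    (phi : B -> B) : Prop :=
  [/\ bijective phi,
      {morph phi : x y / Order.meet x y},
      {morph phi : x y / Order.join x y} &
      {morph phi : x / Order.compl x}].

(* Sums and products of subsets S of A are those of B; S empty or a pair gives
   the constants and the binary operations. *)
Definition complete_subalgebra d (B : ctbDistrLatticeType d)
    (A : set B) : Prop :=
  [/\ forall x, A x -> A (Order.compl x),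
      forall S : set B, S `<=` A -> supremums S `<=` A &
      forall S : set B, S `<=` A -> infimums S `<=` A].

Definition generated_cm d (B : ctbDistrLatticeType d) (M : set B) : set B :=
  smallest (@complete_subalgebra d B) M.

Definition large d (B : ctbDistrLatticeType d) (A : set B) : Prop :=
  complete_subalgebra A /\
  exists2 M : set B, antichain M & generated_cm (A `|` M) = [set: B].

(* The cardinal mu is given by a set of that size. *)
Definition mu_large U (mu : set U) d (B : ctbDistrLatticeType d)
    (A : set B) : Prop :=
  complete_subalgebra A /\
  exists M : set B,
    [/\ antichain M, M #= mu & generated_cm (A `|` M) = [set: B]].

(* Main.v *)
Require Import Defs.
From mathcomp Require Import all_boot all_order.
From mathcomp Require Import boolp classical_sets functions cardinality.

Local Open Scope classical_set_scope.

(** Call m good if for every n the power phi^n either maps m to an element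
    disjoint from m or is the identity below m.  If m is good and b <= m, then
    m meets the sum of the phi-orbit of b, which is a fixed point, exactly in b;
    so the fixed points together with any partition of unity into good elements
    generate B.  As in Frolik's theorem, for each n the unit is a sum of four
    elements each of which is moved off itself by phi^n or fixed pointwise below;
    by distributivity the products of these countably many elements and their
    complements form a partition of unity, into at most 2^aleph_0 good elements.
    If kappa > 2^aleph_0, the differences of successive elements along a branch
    of the Souslinization give an antichain of size 2^aleph_0, with which the
    partition is refined. *)

(** * Partitions of unity in a Boolean algebra *)

Section BooleanAlgebra.
Set Implicit Arguments.
Unset Strict Implicit.
Import Order.Theory.
Local Open Scope order_scope.
Local Open Scope card_scope.
Context {d : Order.disp_t} {B : ctbDistrLatticeType d}.
Implicit Types (x y z a b m : B) (S C M : set B).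

Lemma le_self_compl x : x <= ~` x -> x = \bot.
Proof. by rewrite -disj_leC meetxx => /eqP. Qed.

Lemma le_disjoint_compl x y : x <= y -> x <= ~` y -> x = \bot.
Proof. by move=> xy xny; apply: le_self_compl; rewrite (le_trans xny)// leC. Qed.

Lemma supremumsP (cB : complete_algebra B) S : supremums S (supremum \bot S).
Proof.
rewrite /supremum; case: ifPn => [/eqP->|_].
  by split=> [x []|x _]; exact: le0x.
exact: xgetPex (cB S).
Qed.

Lemma infimumsP (cB : complete_algebra B) S : infimums S (infimum \top S).
Proof.
rewrite /infimum; case: ifPn => [/eqP->|_].
  by split=> [x []|x _]; exact: lex1.
have [s [ubs sub]] := cB (lbound S).
apply: xgetPex; exists s.
by split=> [x Sx|x lx]; [apply: sub => y; exact|exact: ubs].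
Qed.

(** Repeated values and the value [\bot] are allowed, so that every choice function can serve as an
    index. *)
Definition partition_of_unity (I : Type) (p : I -> B) :=
  (forall i j, p i = p j \/ p i <= ~` p j) /\ supremums (range p) \top.

Lemma le_sup_top {I : Type} {p : I -> B} {b x} : supremums (range p) \top ->
  (forall i, b `&` p i <= x) -> b <= x.
Proof.
move=> [_ topp] bx; have: \top <= ~` b `|` x.
  by apply: topp => _ [i _ <-]; rewrite -leBLR diffE complK meetC.
by rewrite -leBLR diffE complK meet1x.
Qed.

Lemma partition_of_unity_meet (I J : Type) (p : I -> B) (q : J -> B) :
  partition_of_unity p -> partition_of_unity q ->
  partition_of_unity (fun ij => p ij.1 `&` q ij.2).
Proof.
move=> [djp supp] [djq supq]; split.
  move=> [i j] [i' j'] /=.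
  have [->|pp] := djp i i'; last by right; rewrite leIxl// (le_trans pp)// leC leIl.
  have [->|qq] := djq j j'; first by left.
  by right; rewrite leIxr// (le_trans qq)// leC leIr.
split=> [x _|x ubx]; first exact: lex1.
apply: (le_sup_top supp) => i; apply: (le_sup_top supq) => j.
by rewrite meet1x; apply: ubx; exists (i, j).
Qed.

Lemma antichain_partition (I : Type) (p : I -> B) :
  partition_of_unity p -> antichain (range p `\` [set \bot]).
Proof.
move=> [djp _]; split=> [x [_ /=]//|_ _ [[i _ <-] _] [[j _ <-] _] pij].
by have [//|] := djp i j; rewrite -disj_leC => /eqP.
Qed.

Lemma partition_of_unity_extend (cB : complete_algebra B) (I : Type) (y : I -> B) :
  (forall i j, i <> j -> y i <= ~` y j) ->
  partition_of_unity (fun o => if o is Some i then y i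
                               else ~` supremum \bot (range y)).
Proof.
move=> djy; have [uby suby] := supremumsP cB (range y).
have yle i : y i <= supremum \bot (range y) by apply: uby; exists i.
split.
  move=> [i|] [j|]; last by left.
  - by have [->|/djy] := pselect (i = j); [left|right].
  - by right; rewrite complK.
  - by right; rewrite leC.
split=> [x _|x ubx]; first exact: lex1.
rewrite -(joinxC (supremum \bot (range y))) leUx; apply/andP; split.
  by apply: suby => _ [i _ <-]; apply: ubx; exists (Some i).
by apply: ubx; exists None.
Qed.

(** * Automorphisms and Frolik's decomposition into moved and fixed pieces *)

Lemma ba_automorphism_iter {phi : B -> B} (n : nat) :
  ba_automorphism phi -> ba_automorphism (iter n phi).
Proof.
move=> [bphi phiI phiU phiC]; elim: n => [|n [bn nI nU nC]].
  by split=> //; exists id.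
split=> /=; first exact: bij_comp.
- by move=> x y /=; rewrite nI phiI.
- by move=> x y /=; rewrite nU phiU.
- by move=> x /=; rewrite nC phiC.
Qed.

Lemma automorphism_le {psi : B -> B} :
  ba_automorphism psi -> {mono psi : x y / x <= y}.
Proof.
by move=> [bpsi psiI _ _] x y; rewrite !leEmeet -psiI (inj_eq (bij_inj bpsi)).
Qed.

Definition fixed_below (psi : B -> B) a := forall x, x <= a -> psi x = x.

Definition moved_or_fixed (psi : B -> B) a :=
  a <= ~` psi a \/ fixed_below psi a.

Lemma moved_or_fixed_le (psi : B -> B) a b : ba_automorphism psi ->
  b <= a -> moved_or_fixed psi a -> moved_or_fixed psi b.
Proof.
move=> autpsi ba [mv|fx]; [left|right].
  by rewrite (le_trans ba)// (le_trans mv)// leC (automorphism_le autpsi).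
by move=> x xb; apply: fx; exact: le_trans ba.
Qed.

(** Zorn's lemma: the sum of a chain of elements disjoint from their images is again one, because of
    any two members of the chain one dominates the other. *)
Lemma maximal_moved (cB : complete_algebra B) (psi : B -> B) :
  ba_automorphism psi ->
  exists2 a, a <= ~` psi a & forall b, b <= ~` psi b -> a <= b -> b = a.
Proof.
move=> autpsi; have psile := automorphism_le autpsi.
have [[g psiK gK] _ _ psiC] := autpsi.
pose R (u v : {x | x <= ~` psi x}) := sval u <= sval v.
have [|r s t rs st|s t st ts|A totA|a maxa] := @Zorn _ R.
- by move=> t; rewrite /R.
- exact: le_trans rs st.
- by apply: val_inj; apply/le_anti/andP.
- pose S := [set sval u | u in A].
  have [ubS lubS] := supremumsP cB S.
  have mvS : supremum \bot S <= ~` psi (supremum \bot S).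
    apply: (lubS) => _ [u Au <-]; rewrite lexC -(gK (sval u)) -psiC psile.
    apply: lubS => _ [v Av <-]; rewrite -psile psiC gK lexC.
    have [uv|vu] := totA u v Au Av.
      by rewrite (le_trans uv)// (le_trans (svalP v)).
    by rewrite (le_trans (svalP u))// leC psile.
  by exists (exist (fun x => is_true (x <= ~` psi x)) _ mvS) => u Au; apply: ubS; exists u.
exists (sval a); first exact: svalP a.
by move=> b mvb ab; have := maxa (exist (fun x => is_true (x <= ~` psi x)) b mvb) ab => <-.
Qed.

(** Besides a maximal [a] disjoint from its image, take [psi a], the inverse image of [a] and the
    remainder [r]. A nonzero element below [r] and disjoint from its image could be added to [a], so
    [psi] is the identity below [r]. *)
Lemma moved_or_fixed_cover (cB : complete_algebra B) (psi : B -> B) :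
  ba_automorphism psi ->
  exists e : nat -> B, (forall k, moved_or_fixed psi (e k)) /\
    forall x, (forall k, x <= ~` e k) -> x = \bot.
Proof.
move=> autpsi; have psile := automorphism_le autpsi.
have [[g psiK gK] psiI psiU psiC] := autpsi.
have [a mva maxa] := maximal_moved cB autpsi.
have gle x y : (g x <= y) = (x <= psi y) by rewrite -psile gK.
pose r := ~` a `&` ~` psi a `&` ~` g a.
have no_moved y : y <= r -> y <= ~` psi y -> y = \bot.
  rewrite !lexI -andbA => /and3P[ya ypsia yga] mvy.
  have ay : a `|` y = a.
    apply: maxa; last exact: leUl.
    rewrite psiU complU leUx !lexI mva ypsia mvy andbT.
    by rewrite lexC -[X in ~` X]gK -psiC psile yga.
  by apply: (@le_disjoint_compl _ a) => //; rewrite -ay leUr.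
have fixr : fixed_below psi r.
  (* [x] minus its inverse image and [x] minus [psi x] are disjoint from their images, hence zero;
     these give the two inequalities. *)
  move=> x xr; apply/eqP; rewrite eq_le; apply/andP; split.
    rewrite -[X in _ <= X]gK psile -diff_eq0; apply/eqP/no_moved.
      exact: le_trans (leBx _ _) xr.
    by rewrite (le_trans (leBx _ _))// diffE psiI psiC gK lexC leIr.
  rewrite -diff_eq0; apply/eqP/no_moved.
    exact: le_trans (leBx _ _) xr.
  by rewrite (le_trans (leBC _ _))// leC psile leBx.
(* The default [\bot] at indices above 3 is trivially moved. *)
exists (nth \bot [:: a; psi a; g a; r]); split.
  move=> [|[|[|[|k]]]] /=; [left|left|left|right|left] => //.
  - by rewrite -psiC psile.
  - by rewrite gK gle psiC.
  - by rewrite nth_nil le0x.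
move=> x xe; apply: (@le_disjoint_compl _ r); last exact: (xe 3%N).
by rewrite /r !lexI (xe 0%N) (xe 1%N) (xe 2%N).
Qed.

(** * Good elements and a partition of unity into them *)

Definition good (phi : B -> B) m := forall n, moved_or_fixed (iter n phi) m.

Lemma good_meetl {phi : B -> B} {a} b : ba_automorphism phi ->
  good phi a -> good phi (a `&` b).
Proof.
move=> autphi ga n.
exact: (moved_or_fixed_le (ba_automorphism_iter n autphi) (leIl _ _)).
Qed.

Lemma good_partition (cB : complete_algebra B) dK (K : orderType dK)
    (phi : B -> B) : distributive_law K B -> card_lt [set: nat * nat] [set: K] ->
  ba_automorphism phi ->
  exists2 p : (nat * nat -> bool) -> B,
    partition_of_unity p & forall F, good phi (p F).
Proof.
move=> distB ltK autphi.
have /choice[e eP] n :=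
  moved_or_fixed_cover cB (ba_automorphism_iter n autphi).
pose a (i : nat * nat) (j : bool) := if j then e i.1 i.2 else ~` e i.1 i.2.
pose p (F : nat * nat -> bool) := infimum \top (range (fun i => a i (F i))).
have ple F i : p F <= a i (F i).
  by have [lbp _] := infimumsP cB (range (fun i => a i (F i))); apply: lbp; exists i.
exists p.
  split.
    move=> F G; have [->|FG] := pselect (F = G); first by left.
    right; have [i Fi] : exists i, F i <> G i.
      by apply: contrapT => FG'; apply/FG/funext => i; apply: contrapT => Fi; apply: FG'; exists i.
    have := ple F i; have := ple G i; rewrite /a.
    case: (F i) (G i) Fi => -[]// _ pG pF.
      by rewrite (le_trans pF)// lexC.
    by rewrite (le_trans pF)// leC.
  (* Distributivity rewrites this sum as the product, over all [n] and [k], of the sum of [e n k]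
     and its complement; each factor is the unit. *)
  suff <- : supremum \bot (range p) = \top by exact: supremumsP.
  rewrite /p -(distB _ _ a ltK); apply/eqP; rewrite -le1x.
  have [_ lbi] := infimumsP cB (range (fun i => supremum \bot (range (a i)))).
  apply: lbi => _ [i _ <-]; have [ubs _] := supremumsP cB (range (a i)).
  rewrite -(joinxC (e i.1 i.2)) leUx; apply/andP; split; apply: ubs.
    by exists true.
  by exists false.
move=> F n; have [eg e0] := eP n.
(* Either [p F] lies below some [e n k], or it avoids all of them and is zero because they cover. *)
have [[k Fk]|nF] := pselect (exists k, F (n, k)).
  apply: moved_or_fixed_le (eg k); first exact: ba_automorphism_iter.
  by have := ple F (n, k); rewrite /a Fk.
left; rewrite (e0 (p F)) ?le0x// => k; have := ple F (n, k); rewrite /a.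
by case: ifPn => // Fk; exfalso; apply: nF; exists k.
Qed.

(** * The subalgebra of fixed points and generation by a good partition *)

Lemma supremums_automorphism {phi : B -> B} {S} {x} : ba_automorphism phi ->
  supremums S x -> supremums (phi @` S) (phi x).
Proof.
move=> autphi [ubx subx]; have phile := automorphism_le autphi.
have [[g phiK gK] _ _ _] := autphi.
split=> [_ [y Sy <-]|y uby]; first by rewrite phile; exact: ubx.
rewrite -(gK y) phile; apply: subx => z Sz.
by rewrite -phile gK; apply: uby; exists z.
Qed.

Lemma infimums_automorphism {phi : B -> B} {S} {x} : ba_automorphism phi ->
  infimums S x -> infimums (phi @` S) (phi x).
Proof.
move=> autphi [lbx inx]; have phile := automorphism_le autphi.
have [[g phiK gK] _ _ _] := autphi.
split=> [_ [y Sy <-]|y lby]; first by rewrite phile; exact: lbx.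
rewrite -(gK y) phile; apply: inx => z Sz.
by rewrite -phile gK; apply: lby; exists z.
Qed.

(** [phi] maps a set of fixed points onto itself, so its sum and its product are fixed by
    uniqueness. *)
Lemma fixed_points_subalgebra (phi : B -> B) : ba_automorphism phi ->
  complete_subalgebra [set x | phi x = x].
Proof.
move=> autphi; have [_ _ _ phiC] := autphi.
have imfix S : S `<=` [set x | phi x = x] -> phi @` S = S.
  move=> Sfix; apply/seteqP; split=> [_ [x Sx <-]|x Sx]; first by rewrite Sfix.
  by exists x => //; exact: Sfix.
split=> [x /= fx|S Sfix x Sx|S Sfix x Sx] /=.
- by rewrite phiC fx.
- apply: is_subset1_supremums (Sx).
  by rewrite -{1}(imfix S Sfix); exact: supremums_automorphism.
- apply: is_subset1_infimums (Sx).
  by rewrite -{1}(imfix S Sfix); exact: infimums_automorphism.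
Qed.

Lemma fixed_orbit_sup (cB : complete_algebra B) (phi : B -> B) b :
  ba_automorphism phi ->
  exists o, [/\ phi o = o, b <= o &
    forall m, good phi m -> b <= m -> o `&` m = b].
Proof.
move=> autphi.
(* The orbit under all integer powers; two exponents avoid inverse iterates. *)
pose O := [set x | exists i j, iter i phi x = iter j phi b].
have [ubO lubO] := supremumsP cB O.
have [[g phiK gK] _ _ _] := autphi.
have bo : b <= supremum \bot O by apply: ubO; exists 0%N, 0%N.
exists (supremum \bot O); split => //.
  have imO : phi @` O = O.
    apply/seteqP; split=> [_ [x [i [j xb]] <-]|x [i [j xb]]].
      by exists i, j.+1; rewrite -iterSr /= xb.
    by exists (g x) => //; exists i.+1, j; rewrite iterSr gK.
  apply: (@is_subset1_supremums _ _ O); last by split.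
  by rewrite -{1}imO; apply: supremums_automorphism.
move=> m gm bm; apply/eqP; rewrite eq_le lexI bo bm !andbT.
rewrite -[X in _ `&` X]complK -diffE leBLR; apply: lubO => x [i [j xb]].
rewrite -leBLR diffE complK.
(* Injectivity cancels the smaller exponent, leaving a power of [phi] or of its inverse. *)
have cases : exists n, x = iter n phi b \/ iter n phi x = b.
  have [ij|ji] := leqP i j.
    exists (j - i)%N; left; have [bi _ _ _] := ba_automorphism_iter i autphi.
    by apply: (bij_inj bi); rewrite xb -iterD subnKC.
  exists (i - j)%N; right; have [bj _ _ _] := ba_automorphism_iter j autphi.
  by apply: (bij_inj bj); rewrite -iterD subnKC// ltnW.
have [n xbn] := cases; have autn := ba_automorphism_iter n autphi.
have nle := automorphism_le autn; have [bn nI _ nC] := autn.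
(* In the moved case [x] is disjoint from [m]; in the fixed case [x] is [b] itself. *)
have [mv|fx] := gm n.
  suff -> : x `&` m = \bot by exact: le0x.
  apply/eqP; rewrite disj_leC; case: xbn => [->|xbn].
    by rewrite lexC (le_trans mv)// leC nle.
  by rewrite -nle nC xbn (le_trans bm).
have -> : x = b; last exact: leIl.
case: xbn => [->|xbn]; first exact: fx.
by apply: (bij_inj bn); rewrite xbn fx.
Qed.

Lemma good_partition_generates (cB : complete_algebra B) (I : Type)
    (phi : B -> B) (p : I -> B) : ba_automorphism phi ->
  partition_of_unity p -> (forall i, good phi (p i)) ->
  generated_cm ([set x | phi x = x] `|` (range p `\` [set \bot])) = [set: B].
Proof.
move=> autphi [_ supp] gp; apply/seteqP; split=> // b _ G /= [[_ Gsup Ginf] subG].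
(* [b] is the sum of its pieces in the [p i]; each piece is the product of [p i] and the orbit sum
   of the piece, which is fixed. *)
apply: (Gsup [set b `&` p i | i in [set i | p i <> \bot]]).
  move=> _ [i pi <-].
  have [o [fo bo oP]] := fixed_orbit_sup cB (b `&` p i) autphi.
  apply: (Ginf [set o; p i]).
    by move=> _ [->|->]; apply: subG; [left|right; split => //; exists i].
  have <- := oP (p i) (gp i) (leIr _ _).
  split=> [_ [->|->]|z zlb]; [exact: leIl|exact: leIr|].
  by rewrite lexI !zlb//; [right|left].
split=> [_ [i _ <-]|z ubz]; first exact: leIl.
apply: (le_sup_top supp) => i.
have [->|pi] := pselect (p i = \bot); first by rewrite meetx0 le0x.
by apply: ubz; exists i.
Qed.

(** * Disjoint differences along a descending chain *)

Lemma descending_chain_differences C t :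
  (forall S, S `<=` C -> S !=set0 -> exists2 m, S m & ubound S m) ->
  (forall s, C s -> t < s) ->
  exists y : B -> B, (forall s, C s -> y s <> \bot) /\
    forall r s, C r -> C s -> r <> s -> y r <= ~` y s.
Proof.
move=> woC tC.
(* [u s] is the next element of [C] below [s], or [t] if there is none. *)
have /choice[u uP] s : exists u, C s -> u < s /\ forall r, C r -> r < s -> r <= u.
  have [Cs|nCs] := pselect (C s); last by exists t.
  have [ne|em] := pselect ([set r | C r /\ r < s] !=set0).
    have [|u [Cu us] ubu] := woC _ _ ne; first by move=> r [].
    by exists u => _; split=> // r Cr rs; exact: ubu.
  exists t => _; split; first exact: tC.
  by move=> r Cr rs; exfalso; apply: em; exists r.
(* The piece at [r] lies below [u s], which the piece at [s] avoids. *)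
have dj r s : C r -> C s -> r < s -> r `\` u r <= ~` (s `\` u s).
  move=> Cr Cs rs; have [_ /(_ r Cr rs) ru] := uP s Cs.
  by rewrite lexC (le_trans (leBC _ _))// leC (le_trans (leBx _ _)).
exists (fun s => s `\` u s); split=> [s Cs /eqP|r s Cr Cs rs].
  by have [us _] := uP s Cs; rewrite diff_eq0 (lt_geF us).
(* Applied to a pair, the hypothesis makes [r] and [s] comparable. *)
have [||m] := woC [set r; s]; first by move=> _ [->|->].
  by exists r; left.
case=> -> ubm.
  rewrite lexC; apply: dj => //; rewrite lt_neqAle ubm ?andbT; last by right.
  by apply/eqP => sr; apply: rs.
apply: dj => //; rewrite lt_neqAle ubm ?andbT; last by left.
exact/eqP.
Qed.

End BooleanAlgebra.

(** * Cardinal bounds for antichains *)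

Section Cardinality.
Set Implicit Arguments.
Unset Strict Implicit.
Import Order.Theory.
Local Open Scope order_scope.
Local Open Scope card_scope.

Lemma card_le_injective (T U : Type) : [set: T] #<= [set: U] ->
  exists f : T -> U, injective f.
Proof.
move=> /card_leP[f]; exists (fun x => val (f (to_setT x))).
move=> x y /val_inj /(@inj _ _ _ f) fxy.
by have := fxy (mem_set I) (mem_set I) => /(congr1 val).
Qed.

Lemma countable_card_lt (I : countType) (U : Type) :
  ~ countable [set: U] -> card_lt [set: I] [set: U].
Proof.
move=> unctbl; split.
  have := countableP [set: I] => /card_le_trans; apply; apply/infiniteP.
  by move=> /finite_set_countable.
by move=> /card_le_trans/(_ (countableP [set: I])).
Qed.

(** A pair is coded by a boolean function on [I + option nat], where [inr None] records whether the
    option is inhabited; this countable index type embeds in [nat]. *)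
Lemma card_cantor_prod_option (I : countType) :
  [set: (I -> bool) * option (nat -> bool)] #<= [set: nat -> bool].
Proof.
pose code (Fo : (I -> bool) * option (nat -> bool)) (j : I + option nat) :=
  match j with
  | inl i => Fo.1 i
  | inr None => isSome Fo.2
  | inr (Some n) => oapp (fun e => e n) false Fo.2
  end.
apply/pcard_leTP/injPex; exists (fun Fo n => oapp (code Fo) false (unpickle n)).
move=> [F o] [G o'] _ _ eqFG.
have eqcode j : code (F, o) j = code (G, o') j.
  by have /(congr1 (fun h => h (pickle j))) := eqFG; rewrite pickleK.
have -> : F = G by apply/funext => i; exact: (eqcode (inl i)).
congr pair; have := eqcode (inr None).
case: o o' eqcode {eqFG} => [e|] [e'|]//= eqcode _; congr Some.
by apply/funext => n; exact: (eqcode (inr (Some n))).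
Qed.

(** An injection with unbounded range would have cofinal image, and regularity would bound the size
    of [K] by that of [X]. *)
Lemma regular_cardinal_bounded_inj dK (K : orderType dK) (X : Type) :
  regular_cardinal K -> card_lt [set: X] [set: K] ->
  exists (g : X -> K) (a : K), injective g /\ forall e, g e < a.
Proof.
move=> [_ regK] [leXK nleKX]; have [g injg] := card_le_injective leXK.
exists g; apply: contrapT => unbounded; apply/nleKX.
apply: card_le_trans (card_image_le g setT); apply: regK => a.
apply: contrapT => nle; apply: unbounded; exists a; split=> // e.
rewrite ltNge; apply/negP => age; apply: nle.
by exists (g e) => //; exists e.
Qed.

(** The predecessors of a node at level [a] form a chain of order type [a], descending in [B]; for
    suitable [a], [X] embeds in it, and its successive differences are disjoint. *)
Lemma souslinization_disjoint_family dK (K : orderType dK) d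
    (B : ctbDistrLatticeType d) (T : set B) (X : Type) :
  regular_cardinal K -> souslinization K T -> card_lt [set: X] [set: K] ->
  exists y : X -> B, (forall e, y e <> \bot) /\
    forall e e', e <> e' -> y e <= ~` y e'.
Proof.
move=> regK [_ [treeT [_ levelT] _ _] _ _] ltXK.
have [g [a [injg ga]]] := regular_cardinal_bounded_inj regK ltXK.
have [t [Tt [f [[_ _ surjf] _]]]] := levelT a.
have /choice[h hP] e : exists s, predecessors (T : set B^d) t s /\ f s = g e.
  by have [s ps fs] := surjf (g e) (ga e); exists s.
have [|s [_]|y [y0 djy]] :=
    @descending_chain_differences _ B (predecessors (T : set B^d) t) t.
- by move=> S SC S0; have [m Sm lbm] := treeT t Tt S SC S0; exists m.
- by rewrite ltEdual.
have Ch e : predecessors (T : set B^d) t (h e) by have [] := hP e.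
exists (y \o h); split=> [e|e e' ee']; first exact: y0.
apply: djy => // hh; apply/ee'/injg.
by have [_ <-] := hP e; have [_ <-] := hP e'; rewrite hh.
Qed.

(** Each [y e] has a nonzero piece in some [p i]; these pieces are pairwise disjoint, hence
    distinct. *)
Lemma card_le_refinement d (B : ctbDistrLatticeType d) (I X : Type)
    (p : I -> B) (y : X -> B) (M : set B) :
  supremums (range p) \top -> (forall e, y e <> \bot) ->
  (forall e e', e <> e' -> y e <= ~` y e') ->
  (forall i e, p i `&` y e <> \bot -> M (p i `&` y e)) ->
  [set: X] #<= M.
Proof.
move=> supp y0 djy Mpy.
have /choice[i iP] e : exists i, p i `&` y e <> \bot.
  apply: contrapT => npy; apply: (y0 e); apply/eqP; rewrite -lex0.
  apply: (le_sup_top supp) => i; rewrite meetC lex0; apply/eqP; apply: contrapT => pye.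
  by apply: npy; exists i.
have inj_py : {in [set: X] &, injective (fun e => p (i e) `&` y e)}.
  move=> e e' _ _ /= pp; apply: contrapT => /djy yy; apply: (iP e).
  apply: (@le_disjoint_compl _ _ _ (y e')); first by rewrite pp leIr.
  exact: le_trans (leIr _ _) yy.
have := inj_card_eq inj_py; rewrite card_eq_le => /andP[_ /card_le_trans]; apply.
by apply: subset_card_le => _ [e _ <-]; exact: Mpy.
Qed.

End Cardinality.

(** * Largeness of the fixed-point algebra, and an antichain of size exactly continuum *)

Theorem theorem3p3 (dK dB : Order.disp_t) (K : orderType dK)
    (B : ctbDistrLatticeType dB) (phi : B -> B)
    (regK : regular_cardinal K)
    (uncountableK : ~ countable [set: K])
    (souslinB : souslin_algebra K B)
    (has_souslinizationB : exists T : set B, souslinization K T)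
    (autophi : ba_automorphism phi) :
  large [set x : B | phi x = x] /\
  (card_lt [set: nat -> bool] [set: K] ->
   mu_large [set: nat -> bool] [set x : B | phi x = x]).
Proof.
have [cB _ distB] := souslinB.
have subA := fixed_points_subalgebra autophi.
have [p unityp goodp] :=
  good_partition cB distB (countable_card_lt (nat * nat)%type uncountableK) autophi.
split.
  split=> //; exists (range p `\` [set \bot%O]).
    exact: antichain_partition.
  exact: good_partition_generates.
move=> ltK; split=> //.
have [T souslinT] := has_souslinizationB.
have [y [y0 djy]] := souslinization_disjoint_family regK souslinT ltK.
(* The family [y] need not sum to the unit; the index [None] carries the rest. *)
have unityr := partition_of_unity_extend cB djy.
set r := (fun o => _) in unityr.
have unityq := partition_of_unity_meet unityp unityr.
set q := (fun ij => _) in unityq.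
exists (range q `\` [set \bot%O]); split.
- exact: antichain_partition.
(* The upper bound counts the indices [(F, o)]; the lower bound needs only the indices
   [(F, Some e)]. *)
- rewrite card_eq_le; apply/andP; split.
    apply: card_le_trans (card_cantor_prod_option (nat * nat)%type).
    apply: card_le_trans (card_image_le q setT).
    by apply: subset_card_le => x [].
  apply: (card_le_refinement unityp.2 y0 djy) => F e qF.
  by split=> //; exists (F, Some e).
- apply: good_partition_generates => // -[F o].
  exact: good_meetl.
Qed.
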